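(* Let $n\geqslant4$ and let $\mathfrak{s}_{2,n+1}$ be the $(n+1)$-dimensional complex algebra with basis $e_1,\ldots,e_{n+1}$ and non-zero commutation relations \[ [e_k,e_n]=e_{k-1},\ k=2,\ldots,n-1,\qquad [e_k,e_{n+1}]=(n-k)e_k,\ k=1,\ldots,n-1,\qquad [e_n,e_{n+1}]=e_n+e_{n+1}. \] Put $\xi_1=e_1$ and $\xi_k=\sum_{j=1}^k\frac{(-1)^{k-j}}{(k-j)!}e_1^{j-2}e_2^{k-j}e_j$ for $k=3,\ldots,n-1$. Then a complete set of generalized Casimir operators of $\mathfrak{s}_{2,n+1}$ (a basis of $\mathrm{Inv}(\mathfrak{s}_{2,n+1})$) is formed by the $n-3$ expressions \[ \xi_1^{-(k-1)\frac{n-2}{n-1}}\,\xi_k,\qquad k=3,\ldots,n-1. \]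
   Context: For a finite-dimensional complex Lie algebra $\mathfrak{g}$ with basis $e_1,\ldots,e_N$, $[e_i,e_j]=c_{ij}^ke_k$, let $x_1,\ldots,x_N$ be the coordinates on $\mathfrak{g}^*$ associated with the dual basis. An invariant of the coadjoint action is a (possibly only locally defined) function $F(x_1,\ldots,x_N)$ invariant under the coadjoint action; such a function satisfies $\sum_{j,k}c_{ij}^kx_k\,\partial F/\partial x_j=0$ for all $i$. The maximal number of functionally independent invariants is $N_\mathfrak{g}=\dim\mathfrak{g}-\sup_x\operatorname{rank}(\sum_k c_{ij}^kx_k)_{i,j}$. A basis (complete set) of invariants is a set of $N_\mathfrak{g}$ functionally independent invariants. Elements of $\mathrm{Inv}(\mathfrak{g})$ (generalized Casimir operators) are obtained from invariants by replacing $x_i$ by $e_i$ (with symmetrization of non-commuting products); here only the mutually commuting elements $e_1,\ldots,e_{n-1}$ occur, so the symmetrization is trivial and $e_i$ may be read as the coordinate $x_i$. Fractional powers are understood as local branches. *)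

(* Defs.v *)
From mathcomp Require Import all_boot all_order all_algebra.
From mathcomp Require Import all_classical all_reals all_analysis.
From mathcomp Require Import complex.

Set Implicit Arguments.
Unset Strict Implicit.
Unset Printing Implicit Defensive.

Import Order.TTheory GRing.Theory Num.Theory.
Import numFieldNormedType.Exports.
Local Open Scope classical_set_scope.
Local Open Scope ring_scope.

(* R[i] packed as a numClosedFieldType: the topology and the normed module
   structure over itself are inferred from this packing, not from R[i]. *)
Definition Cplx (R : realType) : numClosedFieldType := R[i]%C.

Section LieInvariants.
Variables (R : realType) (N : nat).
Local Notation C := (Cplx R).

(* An algebra on C^(N+1) is given by the brackets of its basis vectors:
   br i j = [e_i, e_j], so that br i j 0 k is the structure constant c_ij^k.
   Points of the dual space are row vectors too, x 0 k being x_k. *)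
Variable br : 'I_N.+1 -> 'I_N.+1 -> 'rV[C]_N.+1.

Definition coad_mx (x : 'rV[C]_N.+1) : 'M[C]_N.+1 :=
  \matrix_(i, j) \sum_k br i j 0 k * x 0 k.

(* dim g - sup_x rank (coad_mx x); the supremum of a set of ranks, all of them
   at most N.+1, is a maximum. *)
Definition num_invariants : nat :=
  (N.+1 - \max_(r < N.+2 | `[< exists x, \rank (coad_mx x) = r >]) r)%N.

(* Operators act on row vectors from the right: w *m ad_mx v = [v, w]. *)
Definition ad_mx (v : 'rV[C]_N.+1) : 'M[C]_N.+1 :=
  \matrix_(j, k) \sum_i v 0 i * br i j 0 k.

Definition expmx (A : 'M[C]_N.+1) : 'M[C]_N.+1 :=
  lim (series (fun k => (k`!%:R)^-1 *: A ^+ k) @ \oo).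

(* The coadjoint action of exp v: <coAd v x, w> = <x, exp (- ad v) w>. *)
Definition coAd (v x : 'rV[C]_N.+1) : 'rV[C]_N.+1 :=
  x *m (expmx (- ad_mx v))^T.

(* F is a function defined on U only (its values outside U are irrelevant), so
   it is compared at x and g x for g in a neighbourhood of the identity, which
   may depend on x: a branch of a fractional power can have monodromy along a
   global orbit. *)
Definition coadjoint_invariant (U : set 'rV[C]_N.+1) (F : 'rV[C]_N.+1 -> C) :=
  (forall x, U x -> differentiable F x) /\
  (forall x, U x -> \forall v \near (0 : 'rV[C]_N.+1), F (coAd v x) = F x).

(* As in Olver, Applications of Lie Groups to Differential Equations, 2.1:
   near each point the functions satisfy an analytic relation H = 0, where H
   does not vanish identically on any nonempty open subset of its domain W;
   independence is non-dependence on every nonempty open subset. *)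
Definition functionally_dependent m (U : set 'rV[C]_N.+1)
    (F : 'I_m -> 'rV[C]_N.+1 -> C) :=
  forall x, U x ->
  exists (V : set 'rV[C]_N.+1) (W : set 'rV[C]_m) (H : 'rV[C]_m -> C),
  [/\ [/\ open V, V x & V `<=` U],
      open W /\ (forall y, V y -> W (\row_i F i y)),
      forall z, W z -> differentiable H z,
      forall W' : set 'rV[C]_m, open W' -> W' !=set0 -> W' `<=` W ->
        exists2 z, W' z & H z != 0 &
      forall y, V y -> H (\row_i F i y) = 0].

Definition functionally_independent m (U : set 'rV[C]_N.+1)
    (F : 'I_m -> 'rV[C]_N.+1 -> C) :=
  forall V : set 'rV[C]_N.+1, open V -> V !=set0 -> V `<=` U ->
  ~ functionally_dependent V F.

Definition complete_set_of_invariants m (U : set 'rV[C]_N.+1)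
    (F : 'I_m -> 'rV[C]_N.+1 -> C) :=
  [/\ m = num_invariants,
      forall i, coadjoint_invariant U (F i) &
      functionally_independent U F].

(* p is a branch on U of the multivalued function f ^ a: as numq a and denq a
   are coprime, the solutions w of w ^ denq a = z ^ numq a, for z != 0, are
   exactly the values exp (a * log z). *)
Definition power_branch (U : set 'rV[C]_N.+1) (f : 'rV[C]_N.+1 -> C) (a : rat)
    (p : 'rV[C]_N.+1 -> C) :=
  (forall x, U x -> {for x, continuous p}) /\
  (forall x, U x -> p x ^ denq a = f x ^ numq a).

End LieInvariants.

Section TheAlgebra.
Variables (R : realType) (n : nat).
Local Notation C := (Cplx R).

(* The indices i of e_i and x_i run over 1, ..., n.+1. *)
Definition e_ (i : nat) : 'rV[C]_n.+1 := delta_mx 0 (inord i.-1).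
Definition x_ (i : nat) (x : 'rV[C]_n.+1) : C := x 0 (inord i.-1).

(* The brackets [e_i, e_j] with i < j, where [e_n, e_(n+1)] = w is left as a
   parameter. *)
Definition s2_rel (w : 'rV[C]_n.+1) (i j : nat) : 'rV[C]_n.+1 :=
  if (2 <= i <= n.-1)%N && (j == n) then e_ i.-1
  else if (1 <= i <= n.-1)%N && (j == n.+1) then (n - i)%:R *: e_ i
  else if (i == n) && (j == n.+1) then w
  else 0.

Definition s2_bracket (w : 'rV[C]_n.+1) (i j : 'I_n.+1) : 'rV[C]_n.+1 :=
  s2_rel w i.+1 j.+1 - s2_rel w j.+1 i.+1.

(* Meant for x_1 != 0, because of the factor x_1 ^ -1 in the term j = 1. *)
Definition xi_ (k : nat) (x : 'rV[C]_n.+1) : C :=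
  if k == 1%N then x_ 1 x
  else \sum_(1 <= j < k.+1)
         (-1) ^+ (k - j) / ((k - j)`!)%:R
         * x_ 1 x ^ (j%:Z - 2) * x_ 2 x ^+ (k - j) * x_ j x.

End TheAlgebra.

(* Main.v *)
Require Import Defs.
From mathcomp Require Import all_boot all_order all_algebra.
From mathcomp Require Import all_classical all_reals all_analysis.
From mathcomp Require Import complex ring lra zify.

Import Order.TTheory GRing.Theory Num.Theory.
Import numFieldNormedType.Exports.
Import complex.ComplexField.Normc.
Local Open Scope classical_set_scope.
Local Open Scope ring_scope.

(* All the functions involved depend only on x_1, ..., x_(n-1), the coordinates
   dual to an abelian ideal which every ad v preserves and on which it acts as
   s L + t D, with L e_k = e_(k-1) and D e_k = (n - k) e_k; the value of
   [e_n, e_(n+1)] plays no role. As [D, L] = L, for t <> 0 the exponential of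
   s L + t D is conjugate to that of t D by the unipotent shear exp (u L), while
   for t = 0 it is itself a shear. Now xi_k is x_1^(k-2) times the k-th coordinate
   of x sheared by u = - x_2 / x_1, so it is invariant under shears and is
   multiplied by exp ((k-1)(n-2) t), whereas x_1 is multiplied by
   exp ((n-1) t). The branches follow because two d-th roots of the same
   function which have the same nonzero limit agree near that limit. *)

Set Implicit Arguments.
Unset Strict Implicit.
Unset Printing Implicit Defensive.

(** * Absolute convergence and the exponential over the complex numbers *)

Lemma norm_normc (R : realType) (z : Cplx R) : `|z| = ((normc z)%:C)%C.
Proof. by []. Qed.

Lemma normc_ge0 (R : realType) (z : Cplx R) : 0 <= normc z.
Proof. by case: z => a b; exact: sqrtr_ge0. Qed.

Lemma normcB (R : realType) (z w : Cplx R) : normc (z - w) = normc (w - z).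
Proof. by rewrite -[LHS]normcN opprB. Qed.

Lemma normcX (R : realType) (z : Cplx R) k : normc (z ^+ k) = normc z ^+ k.
Proof.
by elim: k => [|k IH]; rewrite ?expr0 ?normc1 // !exprS normcM IH.
Qed.

Lemma normc_nat (R : realType) k : normc (k%:R : Cplx R) = k%:R.
Proof.
rewrite -(@rmorph_nat _ _ (real_complex R)) /= expr0n addr0 sqrtr_sqr.
by rewrite ger0_norm.
Qed.

Lemma normc_invfact (R : realType) k :
  normc ((k`!%:R)^-1 : Cplx R) = (k`!%:R)^-1.
Proof. by rewrite normcV normc_nat. Qed.

Lemma normc_sum (R : realType) (I : Type) (r : seq I) (P : pred I)
    (f : I -> Cplx R) :
  normc (\sum_(i <- r | P i) f i) <= \sum_(i <- r | P i) normc (f i).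
Proof.
elim/big_ind2: _ => [|x1 x2 y1 y2 h1 h2|//]; first by rewrite normc0.
by apply: le_trans (le_normcD _ _) _; exact: lerD.
Qed.

(** The norm of [Cplx R] takes values in [Cplx R] itself, where a positive radius is necessarily
    real. Passing to the real-valued [normc] gives access to the squeeze theorem and to the order of
    [R]. *)
Lemma cvg_normc (R : realType) (T : Type) (F : set_system T) {FF : Filter F}
    (u : T -> Cplx R) (l : Cplx R) :
  (fun t => normc (u t - l)) @ F --> (0 : R) <-> u @ F --> l.
Proof.
split.
  move=> /cvgrPdist_lt h; apply/cvgrPdist_lt => -[e e'] /=.
  rewrite ltcE /= => /andP[/eqP -> e0].
  near=> t; rewrite norm_normc normcB ltcR -[normc _]ger0_norm ?normc_ge0 //.
  by rewrite -normrN -sub0r; near: t; exact: h.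
move=> /cvgrPdist_lt h; apply/cvgrPdist_lt => e e0.
have e0' : 0 < (e%:C)%C :> Cplx R by rewrite ltcR.
near=> t; rewrite sub0r normrN ger0_norm ?normc_ge0 // -ltcR normcB.
by near: t; exact: h.
Unshelve. all: by end_near. Qed.

Lemma normc_leReIm (R : realType) (a b : R) :
  normc (Complex a b) <= `|a| + `|b|.
Proof.
rewrite /= -[leRHS]ger0_norm ?addr_ge0 // -sqrtr_sqr ler_wsqrtr //.
rewrite sqrrD -[a ^+ 2]real_normK ?num_real // -[b ^+ 2]real_normK ?num_real //.
have : 0 <= `|a| * `|b| by rewrite mulr_ge0.
lra.
Qed.

Lemma normc_geRe (R : realType) (z : Cplx R) : `|complex.Re z| <= normc z.
Proof. by rewrite -lecR; exact: normc_ge_Re. Qed.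

Lemma normc_geIm (R : realType) (z : Cplx R) : `|complex.Im z| <= normc z.
Proof.
case: z => a b /=; rewrite -sqrtr_sqr ler_wsqrtr // lerDr sqr_ge0 //.
Qed.

Lemma cvg_complex (R : realType) (T : Type) (F : set_system T) {FF : Filter F}
    (f g : T -> R) (a b : R) :
  f @ F --> a -> g @ F --> b ->
  (fun t => Complex (f t) (g t) : Cplx R) @ F --> (Complex a b : Cplx R).
Proof.
move=> fa gb; apply/cvg_normc.
have h : (fun t => `|f t - a| + `|g t - b|) @ F --> 0.
  have -> : (0 : R) = `|a - a| + `|b - b| by rewrite !subrr normr0 addr0.
  by apply: cvgD; apply: cvg_norm; apply: cvgB => //; exact: cvg_cst.
apply: (@squeeze_cvgr _ _ _ _ (cst 0)) _ _ h; last exact: cvg_cst.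
by near=> t; rewrite /cst normc_ge0 /=; exact: normc_leReIm.
Unshelve. all: by end_near. Qed.

Lemma cvg_norm_normc (R : realType) (T : Type) (F : set_system T)
    {FF : Filter F} (u : T -> Cplx R) (l : Cplx R) :
  u @ F --> l -> (fun t => normc (u t)) @ F --> normc l.
Proof.
move=> /cvg_normc h; apply/cvgrPdist_le => e e0.
move/cvgrPdist_le: h => /(_ e e0); apply: filterS => t.
rewrite sub0r normrN ger0_norm ?normc_ge0 // => /(le_trans _); apply.
have := le_normcD (u t - l) l; have := le_normcD (l - u t) (u t).
rewrite !subrK (normcB _ l) => h1 h2.
by rewrite ler_norml; apply/andP; split; lra.
Qed.

(** Domination makes the series of real parts and of imaginary parts converge absolutely in [R]; the
    complex limit is assembled from the two. *)
Lemma cvg_series_normc (R : realType) (u : nat -> Cplx R) (b : nat -> R) :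
  (forall k, normc (u k) <= b k) -> cvgn (series b) -> cvgn (series u).
Proof.
move=> ub cb.
have b0 k : 0 <= b k by apply: le_trans (ub k); exact: normc_ge0.
have cvpart (f : nat -> R) : (forall k, `|f k| <= b k) -> cvgn (series f).
  move=> fb; apply: normed_cvg.
  exact: (series_le_cvg (fun k => normr_ge0 (f k)) b0 fb cb).
have cRe := cvpart _ (fun k => le_trans (normc_geRe (u k)) (ub k)).
have cIm := cvpart _ (fun k => le_trans (normc_geIm (u k)) (ub k)).
have uE : series u =
    fun m => Complex (series (fun k => complex.Re (u k)) m)
                     (series (fun k => complex.Im (u k)) m).
  apply/funext => m; rewrite /series /=.
  elim: m => [|m IH]; first by rewrite !big_geq.
  by rewrite !big_nat_recr //= IH; case: (u m).
have cu := cvg_complex (FF := eventually_filter) cRe cIm.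
by rewrite -uE in cu; apply/cvg_ex; eexists; exact: cu.
Qed.

(** Here [u] need not consist of powers, so that both [z ^+ k] and a single entry of [A ^+ k] are
    covered. *)
Lemma exp_series_cvg (R : realType) (a : R) (u : nat -> Cplx R) :
  (forall k, normc (u k) <= a ^+ k) ->
  cvgn (series (fun k => (k`!%:R)^-1 * u k)).
Proof.
move=> ua; apply: cvg_series_normc (is_cvg_series_exp_coeff a) => k.
rewrite normcM normc_invfact mulrC /exp_coeff /=.
by rewrite ler_pM2r // invr_gt0 ltr0n fact_gt0.
Qed.

(** Once the term of index 0 is removed, the triangle inequality compares the rest with the series
    of [expR a - 1]. This measures how the exponential tends to 1 near 0, for numbers and matrices
    alike. *)
Lemma exp_series_dist (R : realType) (a : R) (u : nat -> Cplx R) :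
  (forall k, normc (u k) <= a ^+ k) ->
  normc (limn (series (fun k => (k`!%:R)^-1 * u k)) - u 0) <= expR a - 1.
Proof.
move=> ua; have cu := exp_series_cvg ua.
have c1 : (fun m => normc (series (fun k => (k`!%:R)^-1 * u k) m - u 0)) @ \oo
    --> normc (limn (series (fun k => (k`!%:R)^-1 * u k)) - u 0).
  apply: (cvg_norm_normc (FF := eventually_filter)).
  exact: (cvgB (FF := eventually_filter) cu (cvg_cst (u 0))).
have c2 : (fun m => series (exp_coeff a) m - 1) @ \oo --> expR a - 1.
  by apply: cvgB; [exact: is_cvg_series_exp_coeff | exact: cvg_cst].
apply: ler_cvg_to c1 c2 _.
(* The empty partial sum is skipped: the term of index 0 must be present to cancel. *)
exists 1 => // -[//|m] _.
rewrite /series /= !big_nat_recl //= fact0 invr1 mul1r addrAC subrr add0r.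
rewrite /exp_coeff /= expr0 fact0 divr1 addrAC subrr add0r.
apply: le_trans (normc_sum _ _ _) _; apply: ler_sum => k _.
by rewrite normcM normc_invfact mulrC ler_pM2r // invr_gt0 ltr0n fact_gt0.
Qed.

(** Substitute [j = k - i], then exchange the sums. Both the addition law of the exponential and
    that of the shears rest on this. *)
Lemma cauchy_diag_sum (V : nmodType) (m : nat) (f : nat -> nat -> V) :
  \sum_(i < m) \sum_(j < m | (i + j < m)%N) f i j =
  \sum_(k < m) \sum_(i < k.+1) f i (k - i)%N.
Proof.
transitivity (\sum_(i < m) \sum_(k < m | (i <= k)%N) f i (k - i)%N).
  apply: eq_bigr => i _.
  rewrite -(big_mkord (fun j => (i + j < m)%N) (fun j => f i j)).
  rewrite -(big_mkord (fun k => (i <= k)%N) (fun k => f i (k - i)%N)).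
  rewrite [RHS](@big_cat_nat _ _ _ i) //=; last exact: ltnW.
  rewrite [X in X + _]big_nat_cond [X in X + _]big1 ?add0r; last first.
    by move=> k /andP[/andP[_ ki] ik]; lia.
  rewrite [RHS]big_nat_cond -{3}[nat_of_ord i]add0n big_addn.
  rewrite big_nat_cond [LHS](@big_cat_nat _ _ _ (m - i)) //= ?leq_subr //.
  rewrite [X in _ + X]big_nat_cond [X in _ + X]big1 ?addr0; last first.
    by move=> k /andP[/andP[h1 _] h2]; lia.
  rewrite [LHS]big_nat_cond [RHS]big_nat_cond.
  by apply: congr_big_nat => // k hk; [lia | rewrite addnK].
rewrite (exchange_big_dep xpredT) //=; apply: eq_bigr => k _.
rewrite -(big_mkord (fun i => (i <= k)%N) (fun i => f i (k - i)%N)).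
rewrite -(big_mkord xpredT (fun i => f i (k - i)%N)).
rewrite (@big_cat_nat _ _ _ k.+1) //= [X in _ + X]big_nat_cond.
rewrite [X in _ + X]big1 ?addr0; last first.
  by move=> i /andP[/andP[h1 _] h2]; lia.
by rewrite [LHS]big_nat_cond [RHS]big_nat_cond; apply: eq_bigl => i; lia.
Qed.

Lemma natf_fact_neq0 (F : numFieldType) k : k`!%:R != 0 :> F.
Proof. by rewrite pnatr_eq0 -lt0n fact_gt0. Qed.

(** By the binomial theorem the terms with [i + j < m] form the partial sum at [z + w]. The
    remainder is kept exact: its monomials have positive coefficients, so its norm is bounded by the
    same expression in the norms. *)
Lemma exp_partial_sumM (F : numFieldType) (z w : F) (m : nat) :
  (\sum_(i < m) (i`!%:R)^-1 * z ^+ i) * (\sum_(j < m) (j`!%:R)^-1 * w ^+ j) =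
  \sum_(k < m) (k`!%:R)^-1 * (z + w) ^+ k +
  \sum_(i < m) \sum_(j < m | (m <= i + j)%N)
    ((i`!%:R)^-1 * z ^+ i) * ((j`!%:R)^-1 * w ^+ j).
Proof.
have f0 := natf_fact_neq0 F.
have -> : \sum_(k < m) (k`!%:R)^-1 * (z + w) ^+ k =
    \sum_(i < m) \sum_(j < m | (i + j < m)%N)
      ((i`!%:R)^-1 * z ^+ i) * ((j`!%:R)^-1 * w ^+ j).
  rewrite (cauchy_diag_sum _ (fun i j => ((i`!%:R)^-1 * z ^+ i) *
    ((j`!%:R)^-1 * w ^+ j))).
  apply: eq_bigr => k _; rewrite addrC exprDn mulr_sumr.
  apply: eq_bigr => i _.
  have ik : (i <= k)%N by rewrite -ltnS.
  have := bin_fact ik => /(congr1 (fun n => n%:R : F)); rewrite !natrM => <-.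
  have b0 : 'C(k, i)%:R != 0 :> F.
    apply: contraNneq (f0 k) => b0; rewrite -(bin_fact ik) !natrM b0 mul0r //.
  rewrite -mulr_natl; field.
  by rewrite !f0 b0.
rewrite mulr_suml -big_split; apply: eq_bigr => i _ /=.
rewrite mulr_sumr (bigID (fun j : 'I_m => (i + j < m)%N)) /=.
by congr (_ + _); apply: eq_bigl => j; rewrite -leqNgt.
Qed.

Definition cexp (R : realType) (z : Cplx R) : Cplx R :=
  limn (series (fun k => (k`!%:R)^-1 * z ^+ k)).

Lemma cvg_cexp (R : realType) (z : Cplx R) :
  series (fun k => (k`!%:R)^-1 * z ^+ k) @ \oo --> cexp z.
Proof.
by apply: (@exp_series_cvg _ (normc z)) => k; rewrite normcX.
Qed.
Arguments cvg_cexp {R} z.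

(** The remainder of [exp_partial_sumM] at [z] and [w] is at most, in norm, the one at the real
    numbers [normc z] and [normc w], which tends to 0 by the addition law of [expR]. *)
Lemma cexpD (R : realType) (z w : Cplx R) : cexp (z + w) = cexp z * cexp w.
Proof.
have cz := cvg_cexp z; have cw := cvg_cexp w; have czw := cvg_cexp (z + w).
have cM := cvgB (FF := eventually_filter)
  (cvgM (FF := eventually_filter) cz cw) czw.
apply/esym/eqP; rewrite -subr_eq0; apply/eqP.
apply: (cvg_unique (@norm_hausdorff _ _) cM).
apply/(cvg_normc (FF := eventually_filter)).
have ce (x : R) : series (fun k => (k`!%:R)^-1 * x ^+ k) @ \oo --> expR x.
  rewrite (_ : series _ = series (exp_coeff x)); last by rewrite exp_coeffE.
  exact: is_cvg_series_exp_coeff.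
have cr := cvgB (FF := eventually_filter)
  (cvgM (FF := eventually_filter) (ce (normc z)) (ce (normc w)))
  (ce (normc z + normc w)).
rewrite expRD subrr in cr.
apply: (@squeeze_cvgr _ _ _ _ (cst 0)) _ _ cr; last exact: cvg_cst.
apply: nearW => m; rewrite /cst normc_ge0 /= subr0 !fctE.
rewrite /series /= !big_mkord.
rewrite !exp_partial_sumM.
rewrite addrAC subrr add0r addrAC subrr add0r.
apply: le_trans (normc_sum _ _ _) _; apply: ler_sum => i _.
apply: le_trans (normc_sum _ _ _) _; apply: ler_sum => j _.
by rewrite !normcM !normc_invfact !normcX.
Qed.

Lemma cexp0 (R : realType) : cexp (0 : Cplx R) = 1.
Proof.
(* The choice [a = 0] makes the distance bound [expR a - 1] vanish. *)
have h k : normc ((0 : Cplx R) ^+ k) <= 0 ^+ k by rewrite normcX normc0.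
have := exp_series_dist h; rewrite expR0 subrr expr0 => h0.
apply/eqP; rewrite -subr_eq0; apply/eqP/eq0_normc/eqP.
by rewrite eq_le h0 normc_ge0.
Qed.

Lemma cexpM_natr (R : realType) (z : Cplx R) n : cexp (z * n%:R) = cexp z ^+ n.
Proof.
elim: n => [|n IH]; first by rewrite mulr0 expr0 cexp0.
by rewrite -natr1 mulrDr mulr1 cexpD IH exprSr.
Qed.

Lemma cvg_cexp0 (R : realType) (T : Type) (F : set_system T) {FF : Filter F}
    (f : T -> Cplx R) :
  f @ F --> (0 : Cplx R) -> (fun t => cexp (f t)) @ F --> (1 : Cplx R).
Proof.
move=> f0; apply/cvg_normc.
have h : (fun t => expR (normc (f t)) - 1) @ F --> (0 : R).
  rewrite (_ : 0 = expR 0 - 1 :> R); last by rewrite expR0 subrr.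
  apply: cvgB; last exact: cvg_cst.
  apply: continuous_cvg; first exact: continuous_expR.
  by rewrite -(@normc0 R); apply: cvg_norm_normc.
apply: (@squeeze_cvgr _ _ _ _ (cst 0)) _ _ h; last exact: cvg_cst.
apply: nearW => t; rewrite /cst normc_ge0 /=.
rewrite -[1 in X in X <= _](expr0 (f t)).
by apply: exp_series_dist => k; rewrite normcX.
Qed.

(** * The matrix exponential and continuity of the coadjoint action *)

Lemma cvg_bigsum (K : numFieldType) (T : Type) (F : set_system T)
    {FF : Filter F} (I : Type) (r : seq I) (P : pred I) (f : I -> T -> K)
    (l : I -> K) :
  (forall i, P i -> f i @ F --> l i) ->
  (fun t => \sum_(i <- r | P i) f i t) @ F --> \sum_(i <- r | P i) l i.
Proof. by apply: cvg_big => x; exact: add_continuous. Qed.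

Lemma cvg_mx (K : numFieldType) (m n : nat) (T : Type) (F : set_system T)
    {FF : Filter F} (f : T -> 'M[K]_(m, n)) (L : 'M[K]_(m, n)) :
  (forall i j, (fun t => f t i j) @ F --> L i j) -> f @ F --> L.
Proof.
move=> h; apply/cvg_ballP => e e0.
have h' : \forall t \near F, forall ij : 'I_m * 'I_n,
    ball (L ij.1 ij.2) e (f t ij.1 ij.2).
  apply: filter_forall => -[i j]; move: (h i j) => /cvg_ballP; exact.
by apply: filterS h' => t ht; split => // i j; exact: (ht (i, j)).
Qed.

Lemma cvg_mx_coord (K : numFieldType) (m n : nat) (T : Type) (F : set_system T)
    {FF : Filter F} (f : T -> 'M[K]_(m, n)) (L : 'M[K]_(m, n)) i j :
  f @ F --> L -> (fun t => f t i j) @ F --> L i j.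
Proof.
exact: (continuous_cvg FF (h := fun M : 'M[K]_(m, n) => M i j)
  (@coord_continuous _ _ _ i j L)).
Qed.

(** Each further factor [A] costs a sum of [N.+1] products. The geometric shape of the bound is what
    the exponential series lemmas ask for. *)
Lemma normc_mxX (R : realType) (N : nat) (A : 'M[Cplx R]_N.+1) (a : R) k i j :
  (forall i j, normc (A i j) <= a) ->
  normc ((A ^+ k) i j) <= (N.+1%:R * a) ^+ k.
Proof.
move=> Aa; have a0 : 0 <= a := le_trans (normc_ge0 (A 0 0)) (Aa 0 0).
elim: k i j => [|k IH] i j.
  by rewrite expr0 mxE; case: eqP => _; rewrite ?normc1 ?normc0.
rewrite exprS mxE exprS -mulrA mulr_natl.
apply: le_trans (normc_sum _ _ _) _.
rewrite -[X in _ *+ X]card_ord -sumr_const; apply: ler_sum => l _.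
by rewrite normcM; apply: ler_pM => //; exact: normc_ge0.
Qed.

Lemma mx_bound (R : realType) (N : nat) (A : 'M[Cplx R]_N.+1) :
  forall i j, normc (A i j) <= \sum_i \sum_j normc (A i j).
Proof.
move=> i j; rewrite (bigD1 i) //= (bigD1 j) //= -addrA lerDl addr_ge0 //.
  by apply: sumr_ge0 => *; exact: normc_ge0.
by apply: sumr_ge0 => *; apply: sumr_ge0 => *; exact: normc_ge0.
Qed.

(** [expmx] is a [lim], which is informative only once convergence is known; the limit is found
    entry by entry. *)
Lemma cvg_expmx (R : realType) (N : nat) (A : 'M[Cplx R]_N.+1) :
  series (fun k => (k`!%:R)^-1 *: A ^+ k) @ \oo --> expmx A.
Proof.
apply/cvg_ex.
exists (\matrix_(i, j) limn (series (fun k => (k`!%:R)^-1 * (A ^+ k) i j))).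
apply: (cvg_mx (FF := eventually_filter)) => i j; rewrite mxE.
rewrite (_ : (fun t => _) = series (fun k => (k`!%:R)^-1 * (A ^+ k) i j)).
  apply: exp_series_cvg => k; apply: normc_mxX; exact: mx_bound.
apply/funext => m; rewrite /series /= summxE; apply: eq_bigr => k _.
by rewrite mxE.
Qed.

Lemma cvg_expmx_coord (R : realType) (N : nat) (A : 'M[Cplx R]_N.+1) i j :
  series (fun k => (k`!%:R)^-1 * (A ^+ k) i j) @ \oo --> expmx A i j.
Proof.
have := @cvg_mx_coord _ _ _ _ _ eventually_filter _ _ i j (@cvg_expmx _ _ A).
rewrite (_ : (fun t => _) = series (fun k => (k`!%:R)^-1 * (A ^+ k) i j)) //.
apply/funext => m; rewrite /series /= summxE.
by apply: eq_bigr => k _; rewrite mxE.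
Qed.

Lemma expmx_dist (R : realType) (N : nat) (A : 'M[Cplx R]_N.+1) (a : R) i j :
  (forall i j, normc (A i j) <= a) ->
  normc (expmx A i j - (1 : 'M[Cplx R]_N.+1) i j) <= expR (N.+1%:R * a) - 1.
Proof.
move=> Aa; have h k := @normc_mxX _ _ A a k i j Aa.
have := exp_series_dist h; rewrite expr0.
suff -> : limn (series (fun k => (k`!%:R)^-1 * (A ^+ k) i j)) = expmx A i j.
  by [].
apply: cvg_lim; first exact: norm_hausdorff.
exact: cvg_expmx_coord.
Qed.

Lemma cvg_expmx1 (R : realType) (N : nat) (T : Type) (F : set_system T)
    {FF : Filter F} (A : T -> 'M[Cplx R]_N.+1) :
  A @ F --> (0 : 'M[Cplx R]_N.+1) -> 
  (fun t => expmx (A t)) @ F --> (1 : 'M[Cplx R]_N.+1).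
Proof.
move=> A0; apply: cvg_mx => i j; apply/cvg_normc.
(* The sum of all entry norms bounds every entry and tends to 0 with [A]. *)
pose a t : R := \sum_i \sum_j normc (A t i j).
have a0 : a @ F --> (0 : R).
  rewrite (_ : 0 = \sum_(i < N.+1) \sum_(j < N.+1) normc (0 : Cplx R)); last first.
    by rewrite big1 // => ? _; rewrite big1 // => ? _; rewrite normc0.
  rewrite /a; apply: cvg_bigsum => k _; apply: cvg_bigsum => l _.
  apply: cvg_norm_normc; rewrite (_ : 0 = (0 : 'M[Cplx R]_N.+1) k l).
    exact: cvg_mx_coord A0.
  by rewrite mxE.
have h : (fun t => expR (N.+1%:R * a t) - 1) @ F --> (0 : R).
  rewrite (_ : 0 = expR (N.+1%:R * 0) - 1 :> R); last first.
    by rewrite mulr0 expR0 subrr.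
  apply: cvgB; last exact: cvg_cst.
  apply: continuous_cvg; first exact: continuous_expR.
  by apply: cvgM => //; exact: cvg_cst.
apply: (@squeeze_cvgr _ _ _ _ (cst 0)) _ _ h; last exact: cvg_cst.
apply: nearW => t; rewrite /cst normc_ge0 /=.
by apply: expmx_dist; exact: mx_bound.
Qed.

Lemma cvg_ad_mx0 (R : realType) (N : nat)
    (br : 'I_N.+1 -> 'I_N.+1 -> 'rV[Cplx R]_N.+1) (T : Type)
    (F : set_system T) {FF : Filter F} (v : T -> 'rV[Cplx R]_N.+1) :
  v @ F --> (0 : 'rV[Cplx R]_N.+1) ->
  (fun t => - ad_mx br (v t)) @ F --> (0 : 'M[Cplx R]_N.+1).
Proof.
move=> v0; apply: cvg_mx => i j.
rewrite (_ : (0 : 'M[Cplx R]_N.+1) i j =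
    - \sum_l (0 : 'rV[Cplx R]_N.+1) 0 l * br l i 0 j).
  rewrite (_ : (fun t => _) = (fun t => - \sum_l v t 0 l * br l i 0 j)).
    apply: cvgN; apply: cvg_bigsum => l _; apply: cvgM; last exact: cvg_cst.
    exact: cvg_mx_coord v0.
  by apply/funext => t; rewrite !mxE.
by rewrite mxE big1 ?oppr0 // => l _; rewrite mxE mul0r.
Qed.

(** For small [v] this keeps the orbit point inside an open set and lets a continuous branch be
    followed along the orbit. *)
Lemma cvg_coAd (R : realType) (N : nat)
    (br : 'I_N.+1 -> 'I_N.+1 -> 'rV[Cplx R]_N.+1) (x : 'rV[Cplx R]_N.+1)
    (T : Type) (F : set_system T) {FF : Filter F} (v : T -> 'rV[Cplx R]_N.+1) :
  v @ F --> (0 : 'rV[Cplx R]_N.+1) -> (fun t => coAd br (v t) x) @ F --> x.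
Proof.
move=> v0; have h := cvg_expmx1 (cvg_ad_mx0 br v0).
apply: cvg_mx => i j.
rewrite (_ : x i j = (x *m (1 : 'M[Cplx R]_N.+1)^T) i j); last first.
  by rewrite trmx1 mulmx1.
rewrite mxE (_ : (fun t => _) = (fun t =>
   \sum_l x i l * (expmx (- ad_mx br (v t))) j l)); last first.
  by apply/funext => t; rewrite mxE; apply: eq_bigr => l _; rewrite mxE.
apply: cvg_bigsum => l _; apply: cvgM; first exact: cvg_cst.
by rewrite mxE; exact: cvg_mx_coord (h FF FF).
Qed.

(** * Shears and Casimir functions *)

(** This is the [k]-th coordinate after [exp (u L)], where [L] lowers the index by one. As [i < k],
    the indices read are [1], ..., [k], never 0. *)
Definition shear (F : fieldType) (u : F) (y : nat -> F) (k : nat) : F :=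
  \sum_(i < k) u ^+ i / i`!%:R * y (k - i)%N.

Lemma eq_shear (F : fieldType) (u : F) (y z : nat -> F) (k : nat) :
  (forall j, (1 <= j <= k)%N -> y j = z j) -> shear u y k = shear u z k.
Proof.
move=> yz; apply: eq_bigr => i _; rewrite yz //.
by rewrite subn_gt0 ltn_ord leq_subr.
Qed.

Lemma shear1 (F : fieldType) (u : F) (y : nat -> F) : shear u y 1 = y 1%N.
Proof. by rewrite /shear big_ord1 expr0 fact0 divr1 mul1r. Qed.

Lemma shear2 (F : fieldType) (u : F) (y : nat -> F) :
  shear u y 2 = y 2%N + u * y 1%N.
Proof.
by rewrite /shear !big_ord_recl big_ord0 /= expr0 expr1 !divr1 mul1r addr0.
Qed.

Lemma shear0 (F : fieldType) (y : nat -> F) k : (0 < k)%N -> shear 0 y k = y k.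
Proof.
case: k => // k _; rewrite /shear big_ord_recl expr0 fact0 divr1 mul1r subn0.
by rewrite big1 ?addr0 // => i _; rewrite expr0n !mul0r.
Qed.

(** Lowering the index by [i] raises the weight [l ^+ (m - j)] by [l ^+ i], which absorbs the
    denominator of [(u / l) ^+ i]: a diagonal scaling conjugates one shear to another. *)
Lemma shear_scale (F : fieldType) (u l : F) (y : nat -> F) (m k : nat) :
  l != 0 -> (k <= m)%N ->
  shear (u / l) (fun j => l ^+ (m - j) * y j) k = l ^+ (m - k) * shear u y k.
Proof.
move=> l0 km; rewrite /shear mulr_sumr; apply: eq_bigr => i _.
have -> : (m - (k - i) = (m - k) + i)%N by have := ltn_ord i; lia.
have := expf_neq0 i l0; rewrite exprD expr_div_n.
set a := l ^+ i; set d := (i`!%:R)^-1 => a0.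
by field.
Qed.

(** The one-parameter group law [exp (v L) exp (u L) = exp ((u + v) L)], by the binomial theorem on
    antidiagonals. *)
Lemma shearD (F : numFieldType) (u v : F) (y : nat -> F) k :
  shear v (shear u y) k = shear (u + v) y k.
Proof.
have f0 := natf_fact_neq0 F.
pose G i j := v ^+ i / i`!%:R * (u ^+ j / j`!%:R * y (k - (i + j))%N).
transitivity (\sum_(i < k) \sum_(j < k | (i + j < k)%N) G i j).
  rewrite /shear; apply: eq_bigr => i _; rewrite mulr_sumr.
  rewrite (big_ord_widen k (fun j => v ^+ i / i`!%:R *
     (u ^+ j / j`!%:R * y (k - i - j)%N))) ?leq_subr //.
  by apply: eq_big => j; [lia | rewrite /G subnDA].
rewrite cauchy_diag_sum; apply: eq_bigr => m _.
rewrite exprDn mulrAC mulr_suml mulr_suml; apply: eq_bigr => i _.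
have im : (i <= m)%N by rewrite -ltnS.
rewrite /G subnKC //.
have := bin_fact im => /(congr1 (fun n => n%:R : F)); rewrite !natrM => <-.
have b0 : 'C(m, i)%:R != 0 :> F.
  by apply: contraNneq (f0 m) => b0; rewrite -(bin_fact im) !natrM b0 mul0r.
rewrite -mulr_natl; field.
by rewrite !f0 b0.
Qed.

(** The parameter [- y 2 / y 1] is the one whose shear makes the second coordinate zero, so the
    sheared point is a normal form on its shear orbit; the power of [y 1] clears denominators. *)
Definition casimir (F : fieldType) (y : nat -> F) (k : nat) : F :=
  y 1%N ^ (k%:Z - 2) * shear (- y 2%N / y 1%N) y k.

(** Shearing by [u] first changes the normalizing parameter to [- y 2 / y 1 - u], and the two shears
    add up to the original one. *)
Lemma casimir_shear (F : numFieldType) (u : F) (y : nat -> F) k :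
  y 1%N != 0 -> casimir (shear u y) k = casimir y k.
Proof.
move=> y0; rewrite /casimir shear1 shear2 shearD; congr (_ * shear _ _ _).
by field.
Qed.

Lemma eq_casimir (F : fieldType) (y z : nat -> F) k : (1 < k)%N ->
  (forall j, (1 <= j <= k)%N -> y j = z j) -> casimir y k = casimir z k.
Proof.
move=> k1 yz; rewrite /casimir (eq_shear _ yz) !yz //; lia.
Qed.

(** The weights add up: [(m - 1) * (k - 2)] from the power of [y 1] and [m - k] from the sheared
    coordinate give [(k - 1) * (m - 2)]. *)
Lemma casimir_scale (F : fieldType) (l : F) (y : nat -> F) (m k : nat) :
  l != 0 -> y 1%N != 0 -> (1 < k <= m)%N ->
  casimir (fun j => l ^+ (m - j) * y j) k
  = l ^+ ((k - 1) * (m - 2)) * casimir y k.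
Proof.
move=> l0 y0 km; rewrite /casimir.
have -> : - (l ^+ (m - 2) * y 2%N) / (l ^+ (m - 1) * y 1%N) =
    (- y 2%N / y 1%N) / l.
  have -> : (m - 1 = (m - 2).+1)%N by lia.
  by rewrite exprS; field; rewrite l0 y0 expf_neq0.
rewrite shear_scale //; last by lia.
have -> : k%:Z - 2 = (k - 2)%N by lia.
rewrite -!exprnP exprMn mulrACA -exprM -exprD; congr (_ ^+ _ * _).
by nia.
Qed.

Lemma xi_casimir (R : realType) (n k : nat) (x : 'rV[Cplx R]_n.+1) :
  (1 < k)%N -> x_ 1 x != 0 -> xi_ k x = casimir (fun j => x_ j x) k.
Proof.
move=> k1 x0; rewrite /xi_ (gtn_eqF k1) /casimir /shear mulr_sumr.
(* Reversing the sum matches the term [j] of [xi_] with the term [i = k - j] of the shear. *)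
rewrite big_add1 big_mkord (reindex_inj rev_ord_inj) /=.
apply: eq_bigr => i _; have ik := ltn_ord i.
have -> : (k - i.+1).+1 = (k - i)%N by lia.
rewrite subKn; last by lia.
have -> : (k - i)%N%:Z - 2 = (k%:Z - 2) - i%:Z by lia.
rewrite [x_ 1 x ^ (_ - i%:Z)]expfzDr // -exprnN exprMn_comm; last exact: mulrC.
rewrite exprVn -[- x_ 2 x]mulN1r exprMn_comm; last exact: mulrC.
set p := x_ 1 x ^ _; set a := (-1) ^+ i; set b := x_ 2 x ^+ i.
set c := (x_ 1 x ^+ i)^-1; set d := _^-1.
ring.
Qed.

Lemma cexp_neq0 (R : realType) (z : Cplx R) : cexp z != 0.
Proof.
apply/eqP => z0; have := cexpD z (- z).
by rewrite subrr cexp0 z0 mul0r => /eqP; rewrite oner_eq0.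
Qed.

(* Coordinates of the orbit of [y = Y 0] under the exponential of [s L + t D],
   where [L e_k = e_(k-1)] and [D e_k = (m - k) e_k]; [Y i] is the [i]-th
   iterate. *)
Section Flow.
Variables (R : realType) (m : nat) (s t : Cplx R).
Variables (Y : nat -> nat -> Cplx R) (y' : nat -> Cplx R).
Hypothesis Y_step : forall i k, (1 <= k < m)%N ->
  Y i.+1 k = (if (2 <= k)%N then s * Y i k.-1 else 0) + t * (m - k)%:R * Y i k.
Hypothesis Y_cvg : forall k, (1 <= k < m)%N ->
  series (fun i => (i`!%:R)^-1 * Y i k) @ \oo --> y' k.

(** The shear by [- s / t] diagonalizes [s L + t D]: sheared iterates are multiplied by
    [t * (m - k)] at each step, and the exponential series sums to [cexp t ^+ (m - k)]. *)
Lemma flow_shear k : t != 0 -> (1 <= k < m)%N ->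
  shear (- s / t) y' k = cexp t ^+ (m - k) * shear (- s / t) (Y 0) k.
Proof.
move=> t0 km; set c := - s / t.
have eig i : shear c (Y i) k = (t * (m - k)%:R) ^+ i * shear c (Y 0) k.
  elim: i => [|i IH]; first by rewrite expr0 mul1r.
  rewrite exprS -mulrA -IH /shear mulr_sumr.
  case: k km {IH} => // k km.
  (* [f i0] is the excess of the weight [m - (k.+1 - i0)] over [m - k.+1]. Since [c * t = - s], the
     contribution of [s L] at [i0] is [- f i0.+1], so the sum telescopes; [f 0 = 0], and the last
     index has no [s L] term. *)
  pose f (i0 : nat) := c ^+ i0 / i0`!%:R * (t * i0%:R * Y i (k.+1 - i0)%N).
  have st (i0 : nat) : (i0 < k.+1)%N ->
      c ^+ i0 / i0`!%:R * Y i.+1 (k.+1 - i0)%N =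
      t * (m - k.+1)%:R * (c ^+ i0 / i0`!%:R * Y i (k.+1 - i0)%N) +
      (f i0 - (if (i0 < k)%N then f i0.+1 else 0)).
    move=> ik; rewrite Y_step; last by lia.
    have -> : (m - (k.+1 - i0) = (m - k.+1) + i0)%N by lia.
    rewrite natrD.
    have -> : (2 <= k.+1 - i0)%N = (i0 < k)%N by lia.
    case: ifP => ik' ; last by rewrite /f; ring.
    rewrite /f; have -> : (k.+1 - i0).-1 = (k.+1 - i0.+1)%N by lia.
    rewrite factS natrM exprS.
    have f0 := natf_fact_neq0 (Cplx R) i0.
    have f1 : i0.+1%:R != 0 :> Cplx R by rewrite pnatr_eq0.
    move: (c ^+ i0) => p; rewrite /c; field.
    by rewrite f0 nat1r f1 t0.
  rewrite (eq_bigr _ (fun (j : 'I_k.+1) _ => st j (ltn_ord j))) big_split /=.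
  rewrite [X in _ + X](_ : _ = 0) ?addr0 // sumrB big_ord_recl big_ord_recr /=.
  rewrite ltnn addr0 /f mulr0 mul0r mulr0 add0r; apply/eqP; rewrite subr_eq0.
  by apply/eqP; apply: eq_bigr => j _; rewrite /bump /= add1n ltn_ord.
have c1 : series (fun i => (i`!%:R)^-1 * shear c (Y i) k) @ \oo --> shear c y' k.
  rewrite (_ : series _ = (fun M => \sum_(j < k) c ^+ j / j`!%:R *
     series (fun i => (i`!%:R)^-1 * Y i (k - j)%N) M)); last first.
    apply/funext => M; rewrite /series /=.
    under [RHS]eq_bigr do rewrite mulr_sumr.
    rewrite exchange_big /=; apply: eq_bigr => i _; rewrite /shear mulr_sumr.
    by apply: eq_bigr => j _; rewrite mulrCA.
  apply: (cvg_bigsum (FF := eventually_filter)) => j _.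
  apply: (cvgM (FF := eventually_filter)); first exact: cvg_cst.
  by apply: Y_cvg; have := ltn_ord j; lia.
have c2 : series (fun i => (i`!%:R)^-1 * shear c (Y i) k) @ \oo -->
    cexp (t * (m - k)%:R) * shear c (Y 0) k.
  rewrite (_ : series _ = (fun M => series (fun i => (i`!%:R)^-1 *
    (t * (m - k)%:R) ^+ i) M * shear c (Y 0) k)); last first.
    apply/funext => M; rewrite /series /= mulr_suml.
    by apply: eq_bigr => i _; rewrite eig mulrA.
  apply: (cvgM (FF := eventually_filter)); last exact: cvg_cst.
  exact: cvg_cexp.
rewrite -cexpM_natr.
exact: (cvg_unique (@norm_hausdorff _ _) c1 c2).
Qed.

(** Without [D] the [i]-th iterate is [s ^+ i] times a lowering by [i], which vanishes for [i >= k];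
    the partial sums are constant from [k] on. *)
Lemma flow_nilpotent k : t = 0 -> (1 <= k < m)%N -> y' k = shear s (Y 0) k.
Proof.
move=> t0 km.
have nil i : forall k, (1 <= k < m)%N ->
    Y i k = if (i < k)%N then s ^+ i * Y 0%N (k - i)%N else 0.
  elim: i => [|i IH] {km}k km.
    by rewrite expr0 mul1r subn0; case: ifP => //; lia.
  rewrite Y_step // t0 !mul0r addr0; case: ifP => k2.
    rewrite IH; last by lia.
    have -> : (i < k.-1)%N = (i.+1 < k)%N by lia.
    case: ifP => ik; last by rewrite mulr0.
    by rewrite mulrA -exprS; congr (_ * Y _ _); lia.
  by case: ifP => //; lia.
have := Y_cvg km; move/(cvg_lim (@norm_hausdorff _ _)) => <-.
apply: lim_near_cst; first exact: norm_hausdorff.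
exists k => // M /= kM.
rewrite /series /= (@big_cat_nat _ _ _ k) //=.
rewrite [X in _ + X]big_nat_cond [X in _ + X]big1 ?addr0; last first.
  move=> i /andP[/andP[ki _] _]; rewrite nil //.
  by rewrite ltnNge ki mulr0.
rewrite big_mkord; apply: eq_bigr => i _.
by rewrite nil // ltn_ord mulrA [_^-1 * _]mulrC.
Qed.

Lemma flow_casimir : (2 < m)%N -> Y 0 1 != 0 ->
  y' 1%N = cexp t ^+ (m - 1) * Y 0 1 /\
  forall k, (1 < k < m)%N ->
    casimir y' k = cexp t ^+ ((k - 1) * (m - 2)) * casimir (Y 0) k.
Proof.
move=> m2 Y0; have e0 := cexp_neq0 t.
have [t0|t0] := eqVneq t 0.
  have y'E k : (1 <= k < m)%N -> y' k = shear s (Y 0) k by exact: flow_nilpotent.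
  rewrite t0 cexp0; split=> [|k km]; rewrite expr1n mul1r.
    by rewrite y'E ?shear1 //; lia.
  rewrite -(casimir_shear s k Y0); apply: eq_casimir => [|j jk]; first by lia.
  by apply: y'E; lia.
have fE k : (1 <= k < m)%N -> shear (- s / t) y' k =
  cexp t ^+ (m - k) * shear (- s / t) (Y 0) k by exact: flow_shear.
have y1 : y' 1%N = cexp t ^+ (m - 1) * Y 0 1.
  by have := fE 1%N; rewrite !shear1; apply; lia.
split=> // k km.
(* Both sides are sheared by [- s / t], which does not change [casimir]; the sheared points differ
   by a diagonal scaling only. *)
rewrite -(casimir_shear (- s / t)) ?y1 ?mulf_neq0 ?expf_neq0 //.
rewrite -(casimir_shear (- s / t) k Y0) -casimir_scale ?shear1 //; last by lia.
by apply: eq_casimir => [|j jk]; [lia | apply: fE; lia].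
Qed.

End Flow.

(** * Roots of differentiable functions *)

(** Any continuous linear candidate suffices, since uniqueness of the differential identifies it
    with ['d f x]. *)
Lemma differentiable_epsP (K : numFieldType) (V W : normedModType K)
    (f : V -> W) (df : {linear V -> W}) (x : V) : continuous df ->
  (forall e, 0 < e ->
     \forall h \near (0 : V), `|f (h + x) - f x - df h| <= e * `|h|) ->
  differentiable f x.
Proof.
move=> dfc H.
have E : f \o shift x = cst (f x) + df +o_ 0 id.
  apply/eqaddoP => e e0; near=> h.
  rewrite !fctE /= opprD addrA; near: h; exact: H.
by apply/diff_locallyP; rewrite (diff_unique dfc E).
Unshelve. all: by end_near. Qed.

Lemma differentiable_eps (K : numFieldType) (V W : normedModType K)
    (f : V -> W) (x : V) : differentiable f x ->
  forall e, 0 < e ->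
     \forall h \near (0 : V), `|f (h + x) - f x - 'd f x h| <= e * `|h|.
Proof.
move=> /diff_locally /eqaddoP H e e0; near=> h.
have -> : f (h + x) - f x - 'd f x h =
  (f \o shift x - (cst (f x) + 'd f x)) h by rewrite !fctE /= opprD addrA.
near: h; exact: H.
Unshelve. all: by end_near. Qed.

(** In the manner of Carathéodory, the increment of [p] is that of [q] times a factor continuous at
    [x], so the differential is [T x] times that of [q]. *)
Lemma differentiable_quotient (K : numFieldType) (V : normedModType K)
    (p q T : V -> K) (x : V) :
  differentiable q x -> {for x, continuous T} ->
  (\forall y \near x, p y - p x = (q y - q x) * T y) -> differentiable p x.
Proof.
move=> dq cT pq.
have dqc : continuous ('d q x) by apply: diff_continuous.
have [k k0 kP] := linear_lipschitz dqc.
apply: (@differentiable_epsP _ _ _ _ (T x \*: 'd q x)).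
  by move=> y; apply: cvgM; [exact: cvg_cst | exact: dqc].
move=> e e0.
pose M := `|T x| + 1.
have M0 : 0 < M by rewrite ltr_wpDl.
have shx (P : V -> Prop) : (\forall y \near x, P y) ->
    \forall h \near (0 : V), P (h + x).
  by rewrite (near_shift (0 : V) x); apply: filterS => h /=; rewrite subr0.
have cT1 (d : K) : 0 < d -> \forall h \near (0 : V), `|T x - T (h + x)| < d.
  move=> d0; apply: (shx (fun y => `|T x - T y| < d)).
  by move/cvgrPdist_lt: cT; apply.
have := differentiable_eps dq (e := e / 2 / M).
rewrite !divr_gt0 // => /(_ isT) H.
near=> h.
have -> : p (h + x) - p x = (q (h + x) - q x) * T (h + x).
  by near: h; exact: (shx (fun y => p y - p x = (q y - q x) * T y)).
(* The first product is small because [T] is bounded by [M] near [x]; the second because ['d q x] is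
   Lipschitz and [T] is continuous at [x]. Each receives half of [e]. *)
have -> : (q (h + x) - q x) * T (h + x) - (T x \*: 'd q x) h =
  (q (h + x) - q x - 'd q x h) * T (h + x) - 'd q x h * (T x - T (h + x)).
  by rewrite /= /GRing.scale /=; ring.
apply: le_trans (ler_normB _ _) _; rewrite !normrM [e]splitr mulrDl.
apply: lerD.
  have -> : e / 2 * `|h| = (e / 2 / M * `|h|) * M.
    by field; rewrite lt0r_neq0.
  apply: ler_pM => //; first by near: h; exact: H.
  have : `|T x - T (h + x)| < 1 by near: h; exact: cT1.
  move=> hT; rewrite -[T (h + x)](subKr (T x)).
  by apply: le_trans (ler_normB _ _) _; rewrite lerD2l ltW.
have -> : e / 2 * `|h| = (k * `|h|) * (e / 2 / k).
  by field; rewrite lt0r_neq0.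
apply: ler_pM => //; apply: ltW; near: h; apply: cT1.
by rewrite !divr_gt0.
Unshelve. all: by end_near. Qed.

Lemma cvg_exprn (K : numFieldType) (T : Type) (F : set_system T)
    {FF : Filter F} (f : T -> K) (l : K) n :
  f @ F --> l -> (fun t => f t ^+ n) @ F --> l ^+ n.
Proof.
move=> fl; elim: n => [|n IH].
  by rewrite expr0; under eq_fun do rewrite expr0; exact: cvg_cst.
rewrite exprS (_ : (fun t => _) = (fun t => f t * f t ^+ n)); last first.
  by apply/funext => t; rewrite exprS.
by apply: cvgM.
Qed.

(** The cofactor of [a - b] in [a ^+ d - b ^+ d], written as a polynomial so that it makes sense on
    the diagonal. *)
Definition subX_quot (K : numFieldType) (d : nat) (a b : K) : K :=
  \sum_(i < d) a ^+ (d.-1 - i) * b ^+ i.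

Lemma subX_quotxx (K : numFieldType) (d : nat) (a : K) :
  subX_quot d a a = d%:R * a ^+ d.-1.
Proof.
rewrite /subX_quot (eq_bigr (fun=> a ^+ d.-1)) => [|i _].
  by rewrite sumr_const card_ord mulr_natl.
by rewrite -exprD; congr (_ ^+ _); have := ltn_ord i; lia.
Qed.

Lemma cvg_subX_quot (K : numFieldType) (T : Type) (F : set_system T)
    {FF : Filter F} (f g : T -> K) (l : K) d : (0 < d)%N ->
  f @ F --> l -> g @ F --> l ->
  (fun t => subX_quot d (f t) (g t)) @ F --> d%:R * l ^+ d.-1.
Proof.
move=> d0 fl gl.
rewrite -subX_quotxx.
by apply: cvg_bigsum => i _; apply: cvgM; exact: cvg_exprn.
Qed.

(** The cofactor of [f t - g t] in the difference of [d]-th powers tends to [d%:R * l ^+ d.-1],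
    which is nonzero, so it cannot vanish near the limit. *)
Lemma near_root_unique (K : numFieldType) (T : Type) (F : set_system T)
    {FF : Filter F} (f g : T -> K) (l : K) d : (0 < d)%N -> l != 0 ->
  f @ F --> l -> g @ F --> l ->
  \forall t \near F, f t ^+ d = g t ^+ d -> f t = g t.
Proof.
move=> d0 l0 fl gl; have := cvg_subX_quot (FF := FF) d0 fl gl.
have ln0 : d%:R * l ^+ d.-1 != 0.
  by rewrite mulf_neq0 ?expf_neq0 // pnatr_eq0 -lt0n.
move=> /cvgrPdist_lt /(_ `|d%:R * l ^+ d.-1|); rewrite normr_gt0 => /(_ ln0).
apply: filterS => t St; move/eqP; rewrite -subr_eq0 subrXX mulf_eq0.
case/orP => [|/eqP S0]; first by rewrite subr_eq0 => /eqP.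
by move: St; rewrite /subX_quot S0 subr0 ltxx.
Qed.

(** The increment of [p] is the increment of [q] divided by [subX_quot d (p y) (p x)], which is
    continuous and nonzero at [x]. *)
Lemma differentiable_root (K : numFieldType) (V : normedModType K)
    (p q : V -> K) (x : V) d : (0 < d)%N -> p x != 0 ->
  {for x, continuous p} -> differentiable q x ->
  (\forall y \near x, p y ^+ d = q y) -> differentiable p x.
Proof.
move=> d0 px0 cp dq pq.
have cS : (fun y => subX_quot d (p y) (p x)) @ x --> d%:R * p x ^+ d.-1.
  by apply: cvg_subX_quot => //; exact: cvg_cst.
have ln0 : d%:R * p x ^+ d.-1 != 0.
  by rewrite mulf_neq0 ?expf_neq0 // pnatr_eq0 -lt0n.
apply: (differentiable_quotient (T := fun y => (subX_quot d (p y) (p x))^-1) dq).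
  by rewrite /prop_for /continuous_at subX_quotxx; apply: cvgV.
have qx : p x ^+ d = q x by exact: (nbhs_singleton pq).
have := cS => /cvgrPdist_lt /(_ `|d%:R * p x ^+ d.-1|); rewrite normr_gt0.
move=> /(_ ln0) nS; near=> y.
have Sy : subX_quot d (p y) (p x) != 0.
  have : `|d%:R * p x ^+ d.-1 - subX_quot d (p y) (p x)| <
     `|d%:R * p x ^+ d.-1| by near: y; exact: nS.
  by apply: contraTneq => ->; rewrite subr0 ltxx.
have <- : p y ^+ d = q y by near: y; exact: pq.
by rewrite -qx subrXX -/(subX_quot d _ _) mulfK.
Unshelve. all: by end_near. Qed.

Lemma differentiable_exprz (K : numFieldType) (V : normedModType K)
    (f : V -> K) (x : V) (z : int) :
  f x != 0 -> differentiable f x -> differentiable (fun y => f y ^ z) x.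
Proof.
move=> fx0 df.
have dX n : differentiable (fun y => f y ^+ n) x.
  case: n => [|n].
    by under eq_fun do rewrite expr0; exact: differentiable_cst.
  by rewrite -exprfctE; exact: differentiableX.
case: z => n; first exact: dX.
by apply: differentiableV => //; rewrite expf_neq0.
Qed.

(** * Invariance *)

Section CoadjointOrbit.
Variables (R : realType) (n : nat) (w : 'rV[Cplx R]_n.+1).
Hypothesis n_ge4 : (4 <= n)%N.
Local Notation C := (Cplx R).
Local Notation br := (s2_bracket w).

(** This is the bracket of [e_k] with [v]; it identifies the parameters of the flow as [s = x_ n v]
    and [t = x_ n.+1 v]. *)
Lemma e_mul_ad (v : 'rV[C]_n.+1) k : (1 <= k < n)%N ->
  e_ R n k *m - ad_mx br v =
  (if (2 <= k)%N then x_ n v *: e_ R n k.-1 else 0)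
  + (x_ n.+1 v * (n - k)%:R) *: e_ R n k.
Proof.
move=> kn; rewrite -rowE; apply/rowP => l; rewrite !mxE -sumrN.
have kE : (inord k.-1 : 'I_n.+1).+1 = k by rewrite inordK; lia.
(* Ordinals start at 0: [inord n] stands for [e_(n+1)] and [inord n.-1] for [e_n], the only basis
   vectors that do not commute with the ideal. *)
rewrite (bigD1 (inord n)) //= (bigD1 (inord n.-1)) /=; last first.
  by rewrite -val_eqE /= !inordK //; lia.
have brE (i : 'I_n.+1) : br i (inord k.-1) = - s2_rel w k i.+1.
  rewrite /s2_bracket kE /s2_rel; do !case: ifP; rewrite ?sub0r //; lia.
rewrite big1 => [|i /andP[i1 i2]]; last first.
  rewrite brE /s2_rel; move: i1 i2; rewrite -!val_eqE /= !inordK //; try lia.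
  move=> i1 i2; do !case: ifP; try lia.
  by rewrite !mxE oppr0 mulr0 oppr0.
rewrite addr0 !brE /s2_rel !inordK //; try lia.
have -> : (n.-1.+1 == n) by lia.
have -> : (n.+1 == n) = false by lia.
have -> : (n.-1.+1 == n.+1) = false by lia.
have -> : (k == n) = false by lia.
have -> : (k <= n.-1)%N by lia.
have -> : (1 <= k)%N by lia.
rewrite eqxx !andbT !andbF /= addrC; congr (_ + _).
  by case: ifP => k2; rewrite !mxE ?oppr0 ?mulr0 ?oppr0 // mulrN opprK.
by rewrite !mxE mulrN opprK mulrA.
Qed.

Lemma coAd_flow (x v : 'rV[C]_n.+1) : x_ 1 x != 0 ->
  x_ 1 (coAd br v x) = cexp (x_ n.+1 v) ^+ (n - 1) * x_ 1 x /\
  forall k, (1 < k < n)%N ->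
    xi_ k (coAd br v x) = cexp (x_ n.+1 v) ^+ ((k - 1) * (n - 2)) * xi_ k x.
Proof.
move=> x0; pose A := - ad_mx br v.
(* The pairing of [x] with the [i]-th iterate of [- ad v] on [e_k]; divided by factorials, these sum
   to the [k]-th coordinate of [coAd]. *)
pose Y i k : C := (e_ R n k *m A ^+ i *m x^T) 0 0.
have Y0 k : Y 0%N k = x_ k x.
  by rewrite /Y expr0 mulmx1 -rowE !mxE.
have Ystep i k : (1 <= k < n)%N -> Y i.+1 k =
    (if (2 <= k)%N then x_ n v * Y i k.-1 else 0) +
    x_ n.+1 v * (n - k)%:R * Y i k.
  move=> kn; rewrite /Y exprS -mulmxE mulmxA e_mul_ad // !mulmxDl.
  rewrite -!scalemxAl mxE [in X in _ + X]mxE; congr (_ + _).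
  by case: ifP => k2; rewrite -?scalemxAl ?mul0mx mxE.
have Ycvg k : (1 <= k < n)%N ->
    series (fun i => (i`!%:R)^-1 * Y i k) @ \oo --> x_ k (coAd br v x).
  move=> kn; rewrite /x_ /coAd mxE.
  rewrite (_ : series _ = (fun M => \sum_l x 0 l *
    series (fun i => (i`!%:R)^-1 * (A ^+ i) (inord k.-1) l) M)); last first.
    apply/funext => M; rewrite /series /=.
    under [RHS]eq_bigr do rewrite mulr_sumr.
    rewrite exchange_big /=; apply: eq_bigr => i _.
    rewrite /Y -rowE mxE mulr_sumr; apply: eq_bigr => l _.
    by rewrite !mxE mulrA mulrC.
  apply: (cvg_bigsum (FF := eventually_filter)) => l _.
  apply: (cvgM (FF := eventually_filter)); first exact: cvg_cst.
  by rewrite mxE; exact: cvg_expmx_coord.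
have n2 : (2 < n)%N by lia.
have Y01 : Y 0%N 1%N != 0 by rewrite Y0.
have [y1 yk] := flow_casimir Ystep Ycvg n2 Y01.
have x10 : x_ 1 (coAd br v x) != 0.
  by rewrite y1 Y0 mulf_neq0 ?expf_neq0 // cexp_neq0.
split=> [|k kn]; first by rewrite y1 Y0.
have k1 : (1 < k)%N by lia.
rewrite !xi_casimir // yk //; congr (_ * _).
by apply: eq_casimir => // j _; rewrite Y0.
Qed.

End CoadjointOrbit.

Section Branch.
Variables (R : realType) (n : nat) (n_ge4 : (4 <= n)%N).
Variables (U : set 'rV[Cplx R]_n.+1) (U_open : open U).
Hypothesis U_dom : forall x, U x -> xi_ 1 x != 0.
Variables (k : nat) (k_bound : (3 <= k <= n - 1)%N).
Variable (p : 'rV[Cplx R]_n.+1 -> Cplx R).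
Let a : rat := - ((k%:Q - 1) * ((n%:Q - 2) / (n%:Q - 1))).
Hypothesis p_branch : power_branch U (xi_ 1) a p.

Let x1_neq0 x : U x -> x_ 1 x != 0.
Proof. by move/U_dom; rewrite /xi_ eqxx. Qed.

(** Clearing denominators in the exponent [a] lets [d]-th powers be compared through integer
    exponents only. *)
Lemma exponent_denq : numq a * (n - 1)%N%:Z =
  - ((k - 1) * (n - 2))%N%:Z * denq a.
Proof.
have n1 : n%:Q - 1 != 0.
  rewrite subr_eq0 -[1]/(1%N%:Q) eqr_int; lia.
have d0 : (denq a)%:~R != 0 :> rat by rewrite intr_eq0 denq_neq0.
apply: (@intr_inj rat); rewrite !rmorphM rmorphN rmorphM /=.
have e1 : ((n - 1)%N%:Z)%:~R = n%:Q - 1 :> rat by rewrite -subzn ?rmorphB //; lia.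
have e2 : ((n - 2)%N%:Z)%:~R = n%:Q - 2 :> rat by rewrite -subzn ?rmorphB //; lia.
have e3 : ((k - 1)%N%:Z)%:~R = k%:Q - 1 :> rat by rewrite -subzn ?rmorphB //; lia.
rewrite e1 e2 e3.
have -> : (numq a)%:~R = a * (denq a)%:~R :> rat.
  by rewrite -{2}[a]divq_num_den divfK.
by rewrite /a; field.
Qed.

Lemma branch_denq : exists2 d : nat, (0 < d)%N & denq a = d%:Z.
Proof. by have := denq_gt0 a; case: (denq a) => // d d0; exists d. Qed.

Lemma branch_neq0 x : U x -> p x != 0.
Proof.
move=> Ux; have [d d0 dE] := branch_denq.
have := p_branch.2 x Ux; rewrite dE => pE.
apply/eqP => px0; move/eqP: pE; rewrite px0 /xi_ eqxx exp0rz.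
rewrite eqz_nat -[d == 0%N]negbK -lt0n d0 eq_sym expfz_eq0.
by rewrite (negPf (x1_neq0 Ux)) andbF.
Qed.

Lemma differentiable_x_ i x : differentiable (x_ i : 'rV[Cplx R]_n.+1 -> _) x.
Proof. exact: differentiable_coord. Qed.

Lemma differentiable_branch x : U x -> differentiable p x.
Proof.
move=> Ux; have [d d0 dE] := branch_denq.
apply: (@differentiable_root _ _ p (fun y => x_ 1 y ^ numq a) x d) => //.
- exact: branch_neq0.
- exact: p_branch.1.
- apply: differentiable_exprz; first exact: x1_neq0.
  exact: differentiable_x_.
have := open_nbhs_nbhs (conj U_open Ux); apply: filterS => y Uy.
by have := p_branch.2 y Uy; rewrite dE /xi_ eqxx.
Qed.

Lemma differentiable_xi x : U x -> differentiable (@xi_ R n k) x.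
Proof.
move=> Ux; rewrite /xi_.
have -> : (k == 1%N) = false by lia.
rewrite (_ : (fun y => _) = \sum_(i < k) (fun y : 'rV[Cplx R]_n.+1 =>
  (-1) ^+ (k - i.+1) / ((k - i.+1)`!)%:R * x_ 1 y ^ (i.+1%:Z - 2) *
   x_ 2 y ^+ (k - i.+1) * x_ i.+1 y)); last first.
  by apply/funext => y; rewrite fct_sumE big_add1 big_mkord.
apply: differentiable_sum => i.
apply: differentiableM; last exact: differentiable_x_.
apply: differentiableM.
  apply: differentiableM; first exact: differentiable_cst.
  by apply: differentiable_exprz; [exact: x1_neq0 | exact: differentiable_x_].
case: (k - i.+1)%N => [|m].
  by under eq_fun do rewrite expr0; exact: differentiable_cst.
by rewrite -exprfctE; apply: differentiableX; exact: differentiable_x_.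
Qed.

Lemma branch_xi_invariant (w : 'rV[Cplx R]_n.+1) :
  coadjoint_invariant (s2_bracket w) U (fun x => p x * xi_ k x).
Proof.
split=> x Ux.
  by apply: differentiableM;
    [exact: differentiable_branch | exact: differentiable_xi].
have [d d0 dE] := branch_denq.
have x0 := x1_neq0 Ux.
pose N := ((k - 1) * (n - 2))%N.
have FF : Filter (nbhs (0 : 'rV[Cplx R]_n.+1)) by exact: nbhs_filter.
have cid : (fun v : 'rV[Cplx R]_n.+1 => v) @ nbhs (0 : 'rV[Cplx R]_n.+1) -->
  (0 : 'rV[Cplx R]_n.+1) by exact: cvg_id.
have cx := @cvg_coAd _ _ (s2_bracket w) x _ _ FF _ cid.
have cp : (fun v => p (coAd (s2_bracket w) v x)) @
    nbhs (0 : 'rV[Cplx R]_n.+1) --> p x.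
  exact: (continuous_cvg FF (p_branch.1 x Ux) cx).
(* The value expected of [p] at the orbit point: its factor must cancel the factor [cexp t ^+ N] of
   [xi_ k]. It has the same limit as [p] along the orbit. *)
have cl : (fun v : 'rV[Cplx R]_n.+1 => p x * (cexp (x_ n.+1 v))^-1 ^+ N) @
    nbhs (0 : 'rV[Cplx R]_n.+1) --> p x * 1^-1 ^+ N.
  apply: (cvgM (FF := FF)); first exact: cvg_cst.
  apply: (cvg_exprn (FF := FF)); apply: (cvgV (FF := FF)); first exact: oner_neq0.
  apply: (cvg_cexp0 (FF := FF)).
  rewrite (_ : 0 = x_ n.+1 (0 : 'rV[Cplx R]_n.+1)); last by rewrite /x_ mxE.
  exact: (@cvg_mx_coord _ _ _ _ _ FF _ _ 0 (inord n) cid).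
rewrite invr1 expr1n mulr1 in cl.
have root := near_root_unique (FF := FF) d0 (branch_neq0 Ux) cp cl.
have nU : \forall v \near nbhs (0 : 'rV[Cplx R]_n.+1), U (coAd (s2_bracket w) v x).
  by apply: cx; exact: open_nbhs_nbhs.
near=> v.
have [x1E xkE] := coAd_flow w n_ge4 v x0.
have Uv : U (coAd (s2_bracket w) v x) by near: v; exact: nU.
have e0 := cexp_neq0 (x_ n.+1 v).
rewrite xkE; last by lia.
have -> : p (coAd (s2_bracket w) v x) = p x * (cexp (x_ n.+1 v))^-1 ^+ N.
  suff : p (coAd (s2_bracket w) v x) ^+ d
      = (p x * (cexp (x_ n.+1 v))^-1 ^+ N) ^+ d by near: v; exact: root.
  have := p_branch.2 _ Uv; rewrite dE -exprnP => ->.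
  rewrite /xi_ eqxx x1E exprMn expfzMl.
  have := p_branch.2 _ Ux; rewrite dE -exprnP => ->; rewrite /xi_ eqxx mulrC.
  (* With [l = cexp (x_ n.+1 v)], what remains is that [(l ^ (n - 1)) ^ numq a] is the power of [l]
     of exponent [- N * d]. *)
  congr (_ * _); rewrite [_ ^+ (n - 1)]exprnP exprz_exp.
  rewrite [_ * numq a]mulrC exponent_denq dE.
  by rewrite mulNr -PoszM -exprnN -exprM exprVn.
by rewrite -/N exprVn -mulrA mulKf ?expf_neq0.
Unshelve. all: by end_near. Qed.

End Branch.

(** * The rank of the coadjoint matrix *)

Section Rank.
Variables (R : realType) (n : nat) (w : 'rV[Cplx R]_n.+1).
Hypothesis n_ge4 : (4 <= n)%N.
Local Notation C := (Cplx R).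
Local Notation M := (coad_mx (s2_bracket w)).

(** As [e_1], ..., [e_(n-1)] commute, the matrix vanishes outside its last two rows and columns, so
    it is a sum of two products with the rank 2 projector [D]. *)
Lemma rank_coad_le (x : 'rV[C]_n.+1) : (\rank (M x) <= 4)%N.
Proof.
pose D : 'M[C]_n.+1 :=
  delta_mx (inord n) (inord n) + delta_mx (inord n.-1) (inord n.-1).
have rD : (\rank D <= 2)%N.
  apply: leq_trans (mxrank_add _ _) _; rewrite !mxrank_delta //.
have DE (i j : 'I_n.+1) : D i j = (((i == j) && (n.-1 <= i)%N)%:R : C).
  rewrite !mxE -!val_eqE /= !inordK; try lia.
  have := ltn_ord i; have := ltn_ord j => hj hi.
  have [<-|ij] := eqVneq (i : nat) j.
    have -> : (n.-1 <= i)%N = (i == n :> nat) || (i == n.-1 :> nat) by lia.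
    rewrite !andbb; have [->|] := eqVneq (i : nat) n; last by rewrite add0r.
    have -> : (n == n.-1) = false by lia.
    by rewrite addr0.
  have -> : (i == n :> nat) && (j == n :> nat) = false by lia.
  have -> : (i == n.-1 :> nat) && (j == n.-1 :> nat) = false by lia.
  by rewrite addr0.
have DM (B : 'M[C]_n.+1) i j : (D *m B) i j = ((n.-1 <= i)%N)%:R * B i j.
  rewrite mxE (bigD1 i) //= big1 ?addr0 => [|l li]; first by rewrite DE eqxx.
  by rewrite DE eq_sym (negPf li) mul0r.
have MD (B : 'M[C]_n.+1) i j : (B *m D) i j = B i j * ((n.-1 <= j)%N)%:R.
  rewrite mxE (bigD1 j) //= big1 ?addr0 => [|l lj]; first by rewrite DE eqxx.
  by rewrite DE (negPf lj) mulr0.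
have NE (B : 'M[C]_n.+1) i j : (- B) i j = - B i j by rewrite mxE.
have -> : M x = D *m M x + (M x - D *m M x) *m D.
  apply/matrixP => i j; rewrite [RHS]mxE MD DM [X in _ + X * _]mxE.
  rewrite NE DM; case: (leqP n.-1 i) => hi; first by rewrite mul1r subrr mul0r addr0.
  rewrite !mul0r subr0 add0r.
  case: (leqP n.-1 j) => hj; first by rewrite mulr1.
  rewrite mulr0 mxE big1 // => l _; rewrite /s2_bracket /s2_rel.
  do !case: ifP; rewrite ?mxE ?subr0 ?mul0r //; lia.
apply: leq_trans (mxrank_add _ _) _; rewrite -[4%N]/(2 + 2)%N leq_add //.
  exact: leq_trans (mxrankM_maxl _ _) rD.
exact: leq_trans (mxrankM_maxr _ _) rD.
Qed.

Lemma rank_coad_e1 : (4 <= \rank (M (e_ R n 1)))%N.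
Proof.
(* Rows of [e_1, e_2, e_n, e_(n+1)] against the same indices reversed: the minor is lower triangular
   with diagonal [n - 1, 1, -1, -(n - 1)], the entries from [w] falling below it. *)
pose r (i : 'I_4) : 'I_n.+1 := inord (nth 0%N [:: 0; 1; n.-1; n]%N i).
pose c (i : 'I_4) : 'I_n.+1 := inord (nth 0%N [:: n; n.-1; 1; 0]%N i).
pose B : 'M[C]_4 := mxsub r c (M (e_ R n 1)).
have ME i j : M (e_ R n 1) i j = s2_bracket w i j 0 (inord 0).
  rewrite mxE (bigD1 (inord 0)) //= big1 => [|l l0].
    by rewrite !mxE !eqxx mulr1 addr0.
  by rewrite !mxE eqxx (negPf l0) mulr0.
have delE l : (0 < l <= n.+1)%N -> (e_ R n l 0 (inord 0) : C) = (l == 1%N)%:R.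
  move=> ln; rewrite !mxE eqxx -val_eqE /= !inordK //; last by lia.
  by congr (_%:R); congr nat_of_bool; lia.
have SE i j : (0 < i <= n.+1)%N ->
    s2_rel w i j 0 (inord 0) = if (i == 2) && (j == n) then 1 else
      if (i == 1%N) && (j == n.+1) then (n - 1)%:R else
      if (i == n) && (j == n.+1) then w 0 (inord 0) else 0.
  move=> hi; rewrite /s2_rel.
  case: ifP => h1.
    rewrite delE; last by lia.
    case/andP: h1 => i1 /eqP ->; have [->|i2] := eqVneq i 2; first by rewrite eqxx.
    have -> : (i.-1 == 1%N) = false by lia.
    by rewrite /=; do !case: ifP => //; lia.
  case: ifP => h2.
    rewrite mxE delE //.
    case/andP: h2 => i2 /eqP ->; have [->|i1] := eqVneq i 1%N.
      by rewrite mulr1 /= eqxx.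
    by rewrite mulr0 /=; do !case: ifP => //; lia.
  by do !case: ifP; try lia; rewrite ?mxE.
have BE (i j : 'I_4) : B i j =
    s2_rel w (r i).+1 (c j).+1 0 (inord 0) -
    s2_rel w (c j).+1 (r i).+1 0 (inord 0).
  by rewrite mxE ME /s2_bracket mxE [in X in _ + X]mxE.
have Btrig : is_trig_mx B.
  apply/is_trig_mxP => i j ij; rewrite BE !SE ?ltn_ord //.
  by move: i j ij => [[|[|[|[|i]]]] hi] [[|[|[|[|j]]]] hj] //= _;
    rewrite /r /c /= !inordK; try lia; do !case: ifP; try lia; rewrite subr0.
have dB : \det B != 0.
  rewrite det_trig // prodf_seq_neq0; apply/allP => i _ /=.
  have n1 : (n - 1)%:R != 0 :> C by rewrite pnatr_eq0; lia.
  rewrite BE !SE ?ltn_ord //.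
  by move: i => [[|[|[|[|i]]]] hi] //=; rewrite /r /c /= !inordK; try lia;
    do !case: ifP; try lia; rewrite ?subr0 ?sub0r ?oppr_eq0 ?oner_neq0.
have /eqP <- : row_free B by rewrite row_free_unit unitmxE unitfE.
have -> : B = rowsub r (colsub c (M (e_ R n 1))).
  by apply/matrixP => i j; rewrite !mxE.
apply: leq_trans (mxrankS (rowsub_sub _ _)) _.
rewrite -mxrank_tr -[X in (_ <= X)%N]mxrank_tr trmx_mxsub.
exact: mxrankS (rowsub_sub _ _).
Qed.

Lemma num_invariants_s2 : (n - 3)%N = num_invariants (s2_bracket w).
Proof.
rewrite /num_invariants; set m := \max_(r < _ | _) _.
suff -> : m = 4%N by lia.
apply/eqP; rewrite eqn_leq; apply/andP; split.
  apply/bigmax_leqP => r /asboolP [x <-]; exact: rank_coad_le.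
have n5 : (4 < n.+2)%N by lia.
apply: (@leq_bigmax_cond _ _ (fun r : 'I_n.+2 => r : nat) (Ordinal n5)).
apply/asboolP.
exists (e_ R n 1); apply/eqP.
by rewrite eqn_leq rank_coad_le rank_coad_e1.
Qed.

End Rank.

(** * Functional independence *)

(* A continuous local right inverse makes the image of every neighbourhood
   contain an open set, on which a relation would have to vanish. *)
Lemma independent_of_right_inverse (R : realType) (N m : nat)
    (U : set 'rV[Cplx R]_N.+1) (F : 'I_m -> 'rV[Cplx R]_N.+1 -> Cplx R) :
  open U ->
  (forall x0, U x0 -> exists (G : 'rV[Cplx R]_m -> 'rV[Cplx R]_N.+1),
     [/\ continuous G, G (\row_i F i x0) = x0 &
      \forall y \near x0, forall z, y = G z -> \row_i F i y = z]) ->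
  functionally_independent U F.
Proof.
move=> oU HG V oV [x0 Vx0] VU /(_ _ Vx0).
move=> [V' [W [H [[oV' V'x0 V'V] [oW VW] dH Hn0 H0]]]].
have [G [cG Gx0 nG]] := HG _ (VU _ Vx0).
(* On the preimage of the interior of [A] under [G], each [z] equals [F (G z)] with [G z] in [V'],
   so [H] vanishes there; this preimage is open and contains [F x0]. *)
pose A := [set y | V' y /\ forall z, y = G z -> \row_i F i y = z].
have nA : nbhs x0 A.
  by apply: filterI; [exact: open_nbhs_nbhs | exact: nG].
have oA : open (G @^-1` A°).
  by move: cG => /continuousP; apply; exact: open_interior.
have AG z : (G @^-1` A°) z -> V' (G z) /\ \row_i F i (G z) = z.
  move=> /interior_subset [V'z h]; split=> //; exact: h.
have [||z Az Hz] := Hn0 _ oA.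
- by exists (\row_i F i x0); rewrite /preimage /= Gx0; exact: nA.
- by move=> z /AG [V'z zE]; rewrite -zE; exact: VW.
by have [V'z zE] := AG z Az; move: Hz; rewrite -zE H0 ?eqxx.
Qed.

Section Independence.
Variables (R : realType) (n : nat) (n_ge4 : (4 <= n)%N).
Variables (U : set 'rV[Cplx R]_n.+1) (U_open : open U).
Hypothesis U_dom : forall x, U x -> xi_ 1 x != 0.
Variable p : nat -> 'rV[Cplx R]_n.+1 -> Cplx R.
Hypothesis p_branch : forall k, (3 <= k <= n - 1)%N ->
  power_branch U (xi_ 1) (- ((k%:Q - 1) * ((n%:Q - 2) / (n%:Q - 1)))) (p k).
Local Notation C := (Cplx R).
Local Notation F := (fun (i : 'I_(n - 3)) x => p (i + 3)%N x * xi_ (i + 3)%N x).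

(* The shear by [x_2 / x_1] inverts [x |-> (xi_k / x_1 ^ (k - 2))_k], because
   shears compose additively. *)
Definition casimir_section (x0 : 'rV[C]_n.+1) (z : 'rV[C]_(n - 3)) (j : nat) : C :=
  if (j == 1)%N then x_ 1 x0 else if (j == 2)%N then 0 else
  if insub (j - 3)%N is Some i then
    z 0 i / p j x0 / x_ 1 x0 ^ (j%:Z - 2) else 0.

(** The image is a slice through [x0] on which [x_1], [x_2], [x_n] and [x_(n+1)] keep their values
    at [x0]. As [l] starts at 0, [l.+1 < n] selects [x_1], ..., [x_(n-1)]. *)
Definition right_inverse (x0 : 'rV[C]_n.+1) (z : 'rV[C]_(n - 3)) : 'rV[C]_n.+1 :=
  \row_(l < n.+1) if (l.+1 < n)%N
    then shear (x_ 2 x0 / x_ 1 x0) (casimir_section x0 z) l.+1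
    else x0 0 l.

Lemma continuous_right_inverse x0 : continuous (right_inverse x0).
Proof.
move=> z; have FF : Filter (nbhs z) by exact: nbhs_filter.
apply: (cvg_mx (FF := FF)) => i l; rewrite mxE.
rewrite (_ : (fun t => _) = (fun t => if (l.+1 < n)%N
    then shear (x_ 2 x0 / x_ 1 x0) (casimir_section x0 t) l.+1
    else x0 0 l)); last by apply/funext => t; rewrite mxE.
case: ifP => _; last exact: cvg_cst.
apply: (cvg_bigsum (FF := FF)) => j _.
apply: (cvgM (FF := FF)); first exact: cvg_cst.
rewrite /casimir_section; case: ifP => _; first exact: cvg_cst.
case: ifP => _; first exact: cvg_cst.
case: insub => [a|]; last exact: cvg_cst.
apply: (cvgM (FF := FF)); last exact: cvg_cst.
apply: (cvgM (FF := FF)); last exact: cvg_cst.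
exact: coord_continuous.
Qed.

Lemma x_right_inverse x0 z k : (1 <= k < n)%N ->
  x_ k (right_inverse x0 z) =
  shear (x_ 2 x0 / x_ 1 x0) (casimir_section x0 z) k.
Proof.
move=> kn; rewrite /x_ mxE inordK; last by lia.
have -> : k.-1.+1 = k by lia.
by have -> : (k < n)%N by lia.
Qed.

Lemma xi_right_inverse x0 z (i : 'I_(n - 3)) : U x0 ->
  xi_ (i + 3) (right_inverse x0 z) = z 0 i / p (i + 3)%N x0.
Proof.
move=> Ux0; have x10 : x_ 1 x0 != 0 by have := U_dom Ux0; rewrite /xi_ eqxx.
have hi := ltn_ord i.
have x1E : x_ 1 (right_inverse x0 z) = x_ 1 x0.
  by rewrite x_right_inverse ?shear1 //; lia.
rewrite xi_casimir ?x1E //; last by lia.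
rewrite (@eq_casimir _ _ (shear (x_ 2 x0 / x_ 1 x0) (casimir_section x0 z)));
  [|lia|by move=> j jk; apply: x_right_inverse; lia].
(* After removing the shear, the second coordinate is 0, so the normalizing shear is trivial. *)
rewrite casimir_shear ?/casimir_section ?eqxx //.
rewrite /casimir /= oppr0 mul0r shear0; last by lia.
have -> : (i + 3 == 1)%N = false by lia.
have -> : (i + 3 == 2)%N = false by lia.
rewrite addnK valK.
by rewrite mulrC mulfVK // expfz_neq0.
Qed.

(** At [z = F x0] the section is [x0] sheared to its normal form, and [right_inverse] shears it
    back. *)
Lemma right_inverse_base x0 : U x0 ->
  right_inverse x0 (\row_i F i x0) = x0.
Proof.
move=> Ux0; have x10 : x_ 1 x0 != 0 by have := U_dom Ux0; rewrite /xi_ eqxx.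
apply/rowP => l; rewrite mxE; case: ifP => // ln.
rewrite (@eq_shear _ _ _ (shear (- x_ 2 x0 / x_ 1 x0) (fun j => x_ j x0))).
  rewrite shearD mulNr addNr shear0 // /x_ /=; congr (x0 0 _).
  by apply: val_inj; rewrite /= inordK.
move=> j jl; rewrite /casimir_section.
have [->|j1] := eqVneq j 1%N; first by rewrite shear1.
have [->|j2] := eqVneq j 2%N.
  by rewrite shear2 divfK // subrr.
have hj : (j - 3 < n - 3)%N by lia.
rewrite (insubT (fun k => (k < n - 3)%N) hj) mxE /= subnK; last by lia.
have p0 : p j x0 != 0.
  have jb : (3 <= j <= n - 1)%N by lia.
  exact: (branch_neq0 U_dom (p_branch jb)).
rewrite xi_casimir //; last by lia.
by rewrite [p j x0 * _]mulrC mulfK // /casimir mulrC mulKf // expfz_neq0.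
Qed.

(** Where [x_1] is fixed, [p k] is a continuous root of a constant. This justifies freezing [p] at
    [x0] in the section. *)
Lemma branch_near_cst x0 k : U x0 -> (3 <= k <= n - 1)%N ->
  \forall y \near x0, x_ 1 y = x_ 1 x0 -> p k y = p k x0.
Proof.
move=> Ux0 kb; have pb := p_branch kb.
have [d d0 dE] := branch_denq n k.
have p0 := branch_neq0 U_dom pb Ux0.
have FF : Filter (nbhs x0) by exact: nbhs_filter.
have cp : p k @ nbhs x0 --> p k x0 by exact: pb.1.
have root := near_root_unique (FF := FF) d0 p0 cp (cvg_cst (p k x0)).
have nU : nbhs x0 U by exact: open_nbhs_nbhs.
near=> y => x1E.
have Uy : U y by near: y; exact: nU.
suff : p k y ^+ d = p k x0 ^+ d by near: y; exact: root.
have := pb.2 _ Uy; have := pb.2 _ Ux0; rewrite dE -!exprnP /xi_ eqxx x1E.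
by move=> -> ->.
Unshelve. all: by end_near. Qed.

Lemma casimirs_independent : functionally_independent U F.
Proof.
apply: independent_of_right_inverse => // x0 Ux0.
exists (right_inverse x0); split.
- exact: continuous_right_inverse.
- exact: right_inverse_base.
(* One neighbourhood serves all of the finitely many indices. *)
have nP : \forall y \near x0, forall i : 'I_(n - 3),
    x_ 1 y = x_ 1 x0 -> p (i + 3)%N y = p (i + 3)%N x0.
  apply: (@filter_forall _ _ _ _ (nbhs_filter x0)) => i.
  apply: branch_near_cst => //.
  by have := ltn_ord i; lia.
apply: filterS nP => y yP z yE; apply/rowP => i; rewrite mxE.
have x1E : x_ 1 y = x_ 1 x0.
  by rewrite yE x_right_inverse ?shear1 //; lia.
have ib : (3 <= i + 3 <= n - 1)%N by have := ltn_ord i; lia.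
have p0 := branch_neq0 U_dom (p_branch ib) Ux0.
by rewrite yP // yE xi_right_inverse // mulrC divfK.
Qed.

End Independence.

Unset Implicit Arguments.
Set Strict Implicit.
Set Printing Implicit Defensive.

(* The relation [e_n, e_(n+1)] = e_n + e_(n+1) violates the Jacobi identity and
   is a misprint for e_n + e_(n-1); both versions are asserted. *)
Theorem mainTheorem8 (R : realType) (n : nat) (n_ge4 : (4 <= n)%N)
    (U : set 'rV[Cplx R]_n.+1) (U_open : open U) (U_nonempty : U !=set0)
    (U_dom : forall x, U x -> xi_ 1 x != 0)
    (p : nat -> 'rV[Cplx R]_n.+1 -> Cplx R)
    (p_branch : forall k, (3 <= k <= n - 1)%N ->
       power_branch U (xi_ 1)
         (- ((k%:Q - 1) * ((n%:Q - 2) / (n%:Q - 1)))) (p k)) :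
  let F := fun (i : 'I_(n - 3)) x => let k := (i + 3)%N in p k x * xi_ k x in
  complete_set_of_invariants (s2_bracket (e_ R n n + e_ R n n.+1)) U F /\
  complete_set_of_invariants (s2_bracket (e_ R n n + e_ R n n.-1)) U F.
Proof.
suff main w : complete_set_of_invariants (s2_bracket w) U
    (fun (i : 'I_(n - 3)) x => p (i + 3)%N x * xi_ (i + 3)%N x).
  by split; exact: main.
split; first exact: num_invariants_s2.
  move=> i; have kb : (3 <= i + 3 <= n - 1)%N by have := ltn_ord i; lia.
  exact: (branch_xi_invariant n_ge4 U_open U_dom kb (p_branch _ kb)).
exact: (casimirs_independent n_ge4 U_open U_dom p_branch).
Qed.
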